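(* For $n\ge1$, $U_n=\sum_{k\ge0}2^{n-k-1}R_{n-1,k}$, where $U_n$ and $R_{n,k}$ are defined in the context.
   Context: For $n\ge1$, $S_n$ is the set of permutations of $\{0,\dots,n-1\}$ in one-line notation. $S^3_n$ is the set of pairs $\Pi=(\pi^2,\pi^3)$ of elements of $S_n$ (for $n=0$, the empty permutation); its elements are the columns $\Pi_j=(\pi^2_j,\pi^3_j)^T$ with level $\mathrm{lev}(\Pi_j)=\max\{\pi^2_j,\pi^3_j\}$. $\Pi$ is canonical if $\pi^2=01\cdots(n-1)$. $R_{n,k}$ is the number of canonical $\Pi\in S^3_n$ in which exactly $k$ distinct level values are each attained by two elements ($R_{0,0}=1$, $R_{0,k}=0$ for $k\ge1$). $\Pi$ is unimodal if for some $m$, $\mathrm{lev}(\Pi_1)<\dots<\mathrm{lev}(\Pi_m)>\mathrm{lev}(\Pi_{m+1})>\dots>\mathrm{lev}(\Pi_n)$; $U_n$ is the number of unimodal $\Pi\in S^3_n$. *)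

(* Defs.v *)
From mathcomp Require Import all_boot all_fingroup.

Set Implicit Arguments.
Unset Strict Implicit.
Unset Printing Implicit Defensive.

(* S^3_n: the pair (pi^2, pi^3), each permutation j |-> pi_j being read in
   one-line notation. Positions are numbered from 0. *)
Definition perm3 (n : nat) : predArgType := ('S_n * 'S_n)%type.

Definition row2 n (P : perm3 n) : 'S_n := P.1.
Definition row3 n (P : perm3 n) : 'S_n := P.2.

Definition lev n (P : perm3 n) (j : 'I_n) : nat := maxn (row2 P j) (row3 P j).

Definition canonical n (P : perm3 n) : bool := row2 P == 1%g.

(* Columns of P at distinct positions are distinct, so counting the elements
   of a given level amounts to counting positions; all levels are < n. *)
Definition double_levels n (P : perm3 n) : {set 'I_n} :=
  [set l : 'I_n | #|[set j : 'I_n | lev P j == l]| == 2].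

Definition R (n k : nat) : nat :=
  #|[set P : perm3 n | canonical P & #|double_levels P| == k]|.

(* m is the position of the peak; the inequalities are between consecutive
   positions i and j = i + 1. *)
Definition unimodal n (P : perm3 n) : bool :=
  [exists m : 'I_n, forall i : 'I_n, forall j : 'I_n, (j == i.+1 :> nat) ==>
     ((j <= m) ==> (lev P i < lev P j)) && ((m <= i) ==> (lev P j < lev P i))].

Definition U (n : nat) : nat := #|[set P : perm3 n | unimodal P]|.

(* Main.v *)
Require Import Defs.
From mathcomp Require Import all_boot all_fingroup.
From mathcomp Require Import zify.

Set Implicit Arguments.
Unset Strict Implicit.
Unset Printing Implicit Defensive.

(* Put Pi^3 = sigma o Pi^2: then Pi is an ordering of the columns of the
   canonical pair (1, sigma). A unimodal ordering needs a unique column of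
   maximal level, so sigma fixes n-1. The remaining columns are distributed
   before and after the peak so that no level occurs twice on the same side,
   and this distribution determines the ordering. Levels occur at most twice;
   a level occurring once or twice contributes two choices in both cases, so
   there are 2 ^ (n - 1 - k) orderings when k levels are double. *)

(** * Unimodal functions on positions *)

Definition unimodal_fun n (g : 'I_n -> nat) : bool :=
  [exists m : 'I_n, forall i : 'I_n, forall j : 'I_n, (j == i.+1 :> nat) ==>
     ((j <= m) ==> (g i < g j)) && ((m <= i) ==> (g j < g i))].

(** Induction on the distance turns comparisons of neighbours into comparisons of arbitrary
    positions on one side of the peak. *)
Lemma unimodal_funP n (g : 'I_n -> nat) :
  reflect (exists m : 'I_n,
     (forall i j : 'I_n, i < j -> j <= m -> g i < g j) /\
     (forall i j : 'I_n, i < j -> m <= i -> g j < g i))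
    (unimodal_fun g).
Proof.
apply: (iffP existsP) => [[m /forallP gm]|[m [incr decr]]]; exists m; last first.
  apply/forallP=> i; apply/forallP=> j; apply/implyP=> /eqP ij.
  have lt_ij : i < j by rewrite ij.
  by apply/andP; split; apply/implyP; [apply: incr | apply: decr].
have step (i j : 'I_n) : j = i.+1 :> nat ->
    (j <= m -> g i < g j) /\ (m <= i -> g j < g i).
  move=> ij; move: (gm i) => /forallP/(_ j)/implyP/(_ (introT eqP ij)).
  by case/andP=> /implyP ? /implyP.
have far d (i j : 'I_n) : j = i + d.+1 :> nat ->
    (j <= m -> g i < g j) /\ (m <= i -> g j < g i).
  elim: d j => [|d IHd] j ij; first by apply: step; lia.
  have lt_n : i + d.+1 < n by have := ltn_ord j; lia.
  have [up down] := IHd (Ordinal lt_n) erefl.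
  have [|up' down'] := step (Ordinal lt_n) j; first by rewrite /= ij; lia.
  split=> le_m.
    by apply: ltn_trans (up' le_m); apply: up; rewrite /=; lia.
  by apply: ltn_trans (down le_m); apply: down'; rewrite /=; lia.
have all_far (i j : 'I_n) : i < j ->
    (j <= m -> g i < g j) /\ (m <= i -> g j < g i).
  by move=> lt_ij; apply: (far (j - i).-1); lia.
by split=> i j /all_far[].
Qed.

(** * Permutations as strict linear orders *)

Lemma card_perm_ltn n (s : 'S_n) (x : 'I_n) : #|[set y | s y < s x]| = s x.
Proof.
have -> : [set y | s y < s x] = s @^-1: [set i : 'I_n | i < s x].
  by apply/setP=> y; rewrite !inE.
rewrite card_preimset; last exact: perm_inj.
rewrite -sum1dep_card (big_ord_narrow (ltnW (ltn_ord (s x)))).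
by rewrite sum1_card card_ord.
Qed.

(** Each value is a rank, a number that comparisons alone determine. *)
Lemma eq_perm_ltn n (s1 s2 : 'S_n) :
  (forall x y, (s1 x < s1 y) = (s2 x < s2 y)) -> s1 = s2.
Proof.
move=> eq12; apply/permP=> x; apply: val_inj => /=.
rewrite -(card_perm_ltn s1) -(card_perm_ltn s2).
by apply: eq_card => y; rewrite !inE.
Qed.

(** The permutation is the rank function, counting the elements below [x] for [r]. Irreflexivity
    keeps ranks under [n], transitivity makes them strictly monotone, totality makes them
    distinct. *)
Lemma strict_order_perm n (r : rel 'I_n) :
    irreflexive r -> transitive r -> (forall x y, x != y -> r x y || r y x) ->
  exists s : 'S_n, forall x y, (s x < s y) = r x y.
Proof.
move=> irr tr tot; pose below x := [set y | r y x].
have rank_lt x : #|below x| < n.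
  rewrite -[X in _ < X](card_ord n) -cardsT proper_card //.
  rewrite properE subsetT; apply/subsetPn.
  by exists x; rewrite !inE ?irr.
have mono x y : r x y -> #|below x| < #|below y|.
  move=> rxy; apply/proper_card/properP; split.
    by apply/subsetP=> z; rewrite !inE => /tr; apply.
  by exists x; rewrite !inE ?irr.
pose rank x := Ordinal (rank_lt x).
have rankE x y : (rank x < rank y) = r x y.
  apply/idP/idP => [|/mono //] /=.
  case: (eqVneq x y) => [->|/tot/orP[//|/mono]]; first by rewrite ltnn.
  by move=> /ltnW; rewrite leqNgt => /negPf->.
have rank_inj : injective rank.
  move=> x y eq_xy; apply/eqP/negPn/negP => /tot.
  by rewrite -!rankE eq_xy ltnn.
by exists (perm rank_inj) => x y; rewrite !permE rankE.
Qed.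

(** [A] stands for the columns before the peak. The peak [t] itself is assigned to the complement,
    which makes the splitting unambiguous. *)
Definition two_chains (T V : finType) (f : T -> V) (t : T) (A : {set T}) :=
  [&& t \notin A, dinjectiveb f A & dinjectiveb f (~: A)].

Lemma unimodal_fun_max n (g : 'I_n -> nat) (m : 'I_n) :
    (forall i j : 'I_n, i < j -> j <= m -> g i < g j) ->
    (forall i j : 'I_n, i < j -> m <= i -> g j < g i) ->
  forall i, i != m -> g i < g m.
Proof.
move=> incr decr i; have [im _|mi _|/val_inj->] := ltngtP i m.
- exact: incr im (leqnn m).
- exact: decr mi (leqnn m).
- by rewrite eqxx.
Qed.

(** The order of positions is expressed through the values of [g] and the side of the peak only, so
    that an ordering can be recovered from its splitting. *)
Lemma unimodal_fun_ltn n (g : 'I_n -> nat) (m : 'I_n) :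
    (forall i j : 'I_n, i < j -> j <= m -> g i < g j) ->
    (forall i j : 'I_n, i < j -> m <= i -> g j < g i) ->
  forall i j : 'I_n, (i < j) =
    if i < m then (m <= j) || (g i < g j) else (m <= j) && (g j < g i).
Proof.
move=> incr decr i j.
have [ij|ji|/val_inj<-] := ltngtP i j.
- have [im|mi] := ltnP i m; last by rewrite (decr _ _ ij mi); lia.
  by have [//|/ltnW jm] := leqP m j; rewrite (incr _ _ ij jm).
- have [im|mi] := ltnP i m.
    by have := incr _ _ ji (ltnW im); lia.
  have [mj|//] := leqP m j.
  by have := decr _ _ ji mj; lia.
- by rewrite !ltnn orbF andbF; case: ltnP.
Qed.

(** * Unimodal orderings correspond to splittings into two chains *)

Section UnimodalOrderings.

Variables (n : nat) (f : 'I_n -> 'I_n) (t : 'I_n).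
Hypothesis f_lt_t : forall x, x != t -> f x < f t.

Definition before_peak (p : 'S_n) : {set 'I_n} :=
  [set x | (p^-1)%g x < (p^-1)%g t].

(* The order of the positions: A with increasing f, then its complement, which
   starts with the peak t, with decreasing f. *)
Definition chain_order (A : {set 'I_n}) : rel 'I_n := fun x y =>
  if x \in A then (y \notin A) || (f x < f y)
  else (y \notin A) && (f y < f x).

(** The value at the peak and [f t] are both strict maxima, so [t] sits at the peak. *)
Lemma unimodal_chain_order (p : 'S_n) : unimodal_fun (fun i => f (p i)) ->
  forall x y, ((p^-1)%g x < (p^-1)%g y) = chain_order (before_peak p) x y.
Proof.
case/unimodal_funP=> m [incr decr].
have pm : m = (p^-1)%g t.
  apply/eqP/negPn/negP; set u := (p^-1)%g t => ne_mu.
  have pu : p u = t by rewrite permKV.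
  have := unimodal_fun_max incr decr; move/(_ u).
  rewrite eq_sym pu => /(_ ne_mu).
  have /f_lt_t : p m != t by rewrite -pu (inj_eq perm_inj).
  by lia.
move=> x y; rewrite (unimodal_fun_ltn incr decr) pm !permKV.
by rewrite /chain_order !inE -leqNgt.
Qed.

(** Since [f] is largest at [t], the chain order puts [t] first in the complement of [A]; hence
    exactly [A] precedes it. *)
Lemma chain_order_unimodal (p : 'S_n) (A : {set 'I_n}) : t \notin A ->
    (forall x y, ((p^-1)%g x < (p^-1)%g y) = chain_order A x y) ->
  unimodal_fun (fun i => f (p i)) /\ before_peak p = A.
Proof.
move=> tA ordA.
have ordE (i j : 'I_n) : (i < j) = chain_order A (p i) (p j) by rewrite -ordA !permK.
have befE : before_peak p = A.
  apply/setP=> x; rewrite inE ordA /chain_order (negPf tA) /=.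
  case: ifP => // xA; case: (eqVneq x t) => [->|/f_lt_t]; lia.
split=> //; apply/unimodal_funP; exists ((p^-1)%g t).
have inA i : (p i \in A) = (i < (p^-1)%g t) by rewrite -befE inE permK.
split=> i j ij.
  rewrite leq_eqVlt => /orP[/eqP/val_inj ji|jm].
    rewrite ji permKV; apply: f_lt_t.
    apply: contraTneq ij => pi; rewrite ji -pi permK ltnn //.
  by move: (ij); rewrite ordE /chain_order !inA jm (ltn_trans ij jm).
move=> mi; move: (ij); rewrite ordE /chain_order !inA !(ltnNge _ ((p^-1)%g t)).
by rewrite mi (leq_trans mi (ltnW ij)).
Qed.

Lemma two_chains_order (A : {set 'I_n}) : two_chains f t A ->
  [/\ irreflexive (chain_order A), transitive (chain_order A)
    & forall x y, x != y -> chain_order A x y || chain_order A y x].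
Proof.
case/and3P=> _ /dinjectiveP injA /dinjectiveP injC; rewrite /chain_order.
split=> [x|y x z|x y].
- by rewrite !ltnn; case: (x \in A).
- by case: (x \in A); case: (y \in A); case: (z \in A) => //=; lia.
apply: contraR.
have [xA|xA] := boolP (x \in A); have [yA|yA] := boolP (y \in A) => //= nlt.
  by apply/eqP/injA => //; apply: val_inj => /=; lia.
by apply/eqP/injC; rewrite ?inE //; apply: val_inj => /=; lia.
Qed.

(** Elements of one part with equal [f] are incomparable in the chain order, so they share a
    position. *)
Lemma unimodal_two_chains (p : 'S_n) :
  unimodal_fun (fun i => f (p i)) -> two_chains f t (before_peak p).
Proof.
move=> /unimodal_chain_order ordE; rewrite /two_chains inE ltnn /=.
apply/andP; split; apply/dinjectiveP=> x y xA yA eq_f;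
  apply: (@perm_inj _ (p^-1)%g); apply: val_inj; move: (ordE x y) (ordE y x);
  move: xA yA; rewrite /chain_order ?[_ \in ~: _]inE.
  by move=> -> ->; rewrite eq_f /= ltnn; lia.
by move=> /negPf -> /negPf ->; rewrite eq_f /= ltnn; lia.
Qed.

(** [before_peak] is a bijection: the chain order of its value determines [p], and ranking the chain
    order of any admissible [A] yields a preimage. *)
Lemma card_unimodal_orderings :
  #|[set p : 'S_n | unimodal_fun (fun i => f (p i))]|
    = #|[set A | two_chains f t A]|.
Proof.
rewrite -(@card_in_imset _ _ before_peak).
  apply: eq_card => A; rewrite [RHS]inE; apply/imsetP/idP => [[p + ->]|tcA].
    by rewrite inE => /unimodal_two_chains.
  have [irr tr tot] := two_chains_order tcA.
  have [s sE] := strict_order_perm irr tr tot.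
  have tA : t \notin A by case/and3P: tcA.
  have [|up eqA] := @chain_order_unimodal (s^-1)%g _ tA.
    by move=> x y; rewrite invgK.
  by exists (s^-1)%g; rewrite ?inE.
move=> p q; rewrite !inE => up uq eqA; apply: invg_inj; apply: eq_perm_ltn.
by move=> x y; rewrite !unimodal_chain_order // eqA.
Qed.

End UnimodalOrderings.

(** * Counting splittings when fibers have at most two elements *)

Section TwoChains.

Variables (T V : finType) (f : T -> V) (t : T).
Hypothesis fiber2 : forall v, #|[set x | f x == v]| <= 2.
Hypothesis fiber_t : forall x, f x = f t -> x = t.

(** A chosen element of the fiber of [x]. The predicate depends on [f x] only, so the choice is
    constant on fibers. *)
Let rep x := odflt x [pick y | f y == f x].
Let reps := [set x | rep x == x].

Let f_rep x : f (rep x) = f x.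
Proof. by rewrite /rep; case: pickP => //= y /eqP. Qed.

Let eq_rep x y : f x = f y -> rep x = rep y.
Proof. by rewrite /rep => ->; case: pickP => //= /(_ y); rewrite eqxx. Qed.

Let other x y : f x = f y -> x != rep x -> y != rep x -> x = y.
Proof.
move=> fxy xr yr; apply/eqP/negPn/negP => xy.
have := leq_trans _ (fiber2 (f x)); move/(_ 3).
suff -> : 2 < #|[set z | f z == f x]| by move/(_ isT).
have <- : #|[set x; y; rep x]| = 3.
  by rewrite setUC cardsU1 cards2 !inE xy eq_sym (negPf xr) eq_sym (negPf yr).
apply: subset_leq_card; apply/subsetP=> z; rewrite !inE.
by move=> /orP[/orP[]|] /eqP->; rewrite ?f_rep ?fxy.
Qed.

(** [f] maps the elements that are not representatives bijectively onto the values attained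
    twice. *)
Let card_nonreps : #|~: reps| = #|[set v | #|[set x | f x == v]| == 2]|.
Proof.
rewrite -(@card_in_imset _ _ f).
  apply: eq_card => v; rewrite [RHS]inE; apply/imsetP/idP => [[x + ->]|].
    rewrite !inE => xr; rewrite eqn_leq fiber2 /=.
    have <- : #|[set rep x; x]| = 2 by rewrite cards2 xr.
    apply: subset_leq_card; apply/subsetP=> z; rewrite !inE.
    by case/orP=> /eqP->; rewrite ?f_rep.
  case/cards2P=> x [y [xy eqF]].
  have fx : f x = v by apply/eqP; have := set21 x y; rewrite -eqF inE.
  have fy : f y = v by apply/eqP; have := set22 x y; rewrite -eqF inE.
  have rxy : rep x = rep y by apply: eq_rep; rewrite fx.
  have [rx|rx] := eqVneq (rep x) x; last by exists x; rewrite ?inE.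
  by exists y; rewrite ?inE // -rxy rx.
move=> x y; rewrite !inE => xr yr fxy.
by apply: other; rewrite // eq_sym // (eq_rep fxy).
Qed.

(** A splitting amounts to a free choice of side for each representative other than [t]; the second
    element of a fiber is forced to the opposite side. *)
Lemma card_two_chains :
  #|[set A | two_chains f t A]|
    = 2 ^ (#|T|.-1 - #|[set v | #|[set x | f x == v]| == 2]|).
Proof.
have rep_t : rep t = t by apply: fiber_t.
have -> : #|T|.-1 - #|[set v | #|[set x | f x == v]| == 2]| = #|reps :\ t|.
  rewrite -card_nonreps -(cardsC reps) (cardsD1 t reps) inE rep_t eqxx.
  by rewrite addSn /= addnK.
(* A representative lies in [split_of W] when it lies in [W], any other element when its
   representative does not. *)
pose split_of (W : {set T}) := [set x | (rep x == x) == (rep x \in W)].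
rewrite -card_powerset -[RHS](@card_in_imset _ _ split_of).
  apply: eq_card => A; rewrite [LHS]inE; apply/idP/imsetP => [|[W + ->]].
    case/and3P=> tA /dinjectiveP injA /dinjectiveP injC.
    exists (A :&: reps).
      rewrite inE; apply/subsetP=> x; rewrite !inE => /andP[xA ->].
      by rewrite andbT; apply: contraNneq tA => <-.
    apply/setP=> x; rewrite !inE (eq_rep (f_rep x)) eqxx andbT.
    have [->|rx] := eqVneq (rep x) x; first by case: (x \in A).
    have [xA|xA] := boolP (x \in A); have [rA|rA] := boolP (rep x \in A) => //.
      by rewrite (injA _ _ rA xA (f_rep x)) eqxx in rx.
    by rewrite (injC (rep x) x) ?inE ?f_rep ?eqxx in rx.
  rewrite inE subsetD1 => /andP[_ tW].
  rewrite /two_chains inE rep_t eqxx (negPf tW) /=.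
  have inj_split x y : f x = f y ->
      ((rep x == x) == (rep x \in W)) = ((rep y == y) == (rep y \in W)) -> x = y.
    move=> fxy; rewrite -(eq_rep fxy) => eqW.
    have eq_xy : (rep x == x) = (rep x == y).
      by move: eqW; case: (_ \in W); case: (_ == x); case: (_ == y).
    have [rx|rx] := eqVneq (rep x) x.
      by move/esym: eq_xy; rewrite rx eqxx => /eqP.
    by apply: other; rewrite // eq_sym // -eq_xy.
  apply/andP; split; apply/dinjectiveP=> x y; rewrite !inE => xA yA fxy;
    apply: inj_split => //; first by rewrite xA yA.
  by rewrite (negPf xA) (negPf yA).
(* Injectivity: on representatives [split_of W] agrees with [W], and [W1] and [W2] contain nothing
   else. *)
move=> W1 W2; rewrite !inE => /subsetP sW1 /subsetP sW2 /setP eqW.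
apply/setP=> x; have := eqW x; rewrite !inE.
have [->|rx] := eqVneq (rep x) x; first by case: (x \in W1); case: (x \in W2).
move=> _; transitivity false; last symmetry; apply/negP.
  by move/sW1; rewrite !inE (negPf rx) andbF.
by move/sW2; rewrite !inE (negPf rx) andbF.
Qed.

End TwoChains.

(** * Levels of the columns of a canonical pair *)

Definition column_level n (s : 'S_n) (x : 'I_n) : 'I_n :=
  if x < s x then s x else x.

Lemma val_column_level n (s : 'S_n) x : column_level s x = maxn x (s x) :> nat.
Proof. by rewrite /column_level /maxn; case: ifP. Qed.

(** Only the columns at [v] and at the preimage of [v] under [s] can have level [v]. *)
Lemma column_level_fiber n (s : 'S_n) v :
  #|[set x | column_level s x == v]| <= 2.
Proof.
apply: (@leq_trans #|[set v; (s^-1)%g v]|); last by rewrite cards2; case: eqP.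
apply: subset_leq_card; apply/subsetP=> x; rewrite !inE /column_level.
by case: ifP => _ /eqP <-; rewrite ?permK eqxx ?orbT.
Qed.

Definition double_column_levels n (s : 'S_n) : {set 'I_n} :=
  [set v | #|[set x | column_level s x == v]| == 2].

Lemma double_levels_canonical n (s : 'S_n) :
  double_levels ((1%g, s) : perm3 n) = double_column_levels s.
Proof.
apply/setP=> v; rewrite !inE; congr (_ == _); apply: eq_card => x.
by rewrite !inE /lev /row2 /row3 /= perm1 -val_column_level.
Qed.

Lemma card_canonical n k :
  R n k = \sum_(s : 'S_n) (#|double_column_levels s| == k).
Proof.
rewrite -big_mkcond sum1dep_card /R.
rewrite -(@card_imset _ _ (fun s : 'S_n => (1%g, s) : perm3 n)); last first.
  by move=> s1 s2 [].
apply: eq_card => -[p s]; rewrite inE; apply/idP/imsetP => [|[s' + [-> ->]]].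
  rewrite /canonical /row2 /= => /andP[/eqP-> dbl]; exists s => //.
  by rewrite inE -double_levels_canonical.
by rewrite inE /canonical /row2 /= eqxx double_levels_canonical.
Qed.

Lemma card_unimodal n : U n =
  \sum_(s : 'S_n) #|[set p : 'S_n | unimodal_fun (fun i => column_level s (p i))]|.
Proof.
rewrite /U -sum1dep_card.
(* Column [i] of the pair built from [(s, p)] is column [p i] of the canonical pair [(1, s)]. *)
rewrite (reindex (fun q : 'S_n * 'S_n => (q.2, (q.2 * q.1)%g) : perm3 n)) /=.
  under [RHS]eq_bigr do rewrite -sum1dep_card.
  rewrite pair_big_dep /=; apply: eq_bigl => -[s p] /=.
  apply: eq_existsb => m; apply: eq_forallb => i; apply: eq_forallb => j.
  by rewrite /lev /row2 /row3 /= !permM -!val_column_level.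
exists (fun P : perm3 n => ((P.1^-1 * P.2)%g, P.1)) => -[p s] _ /=.
  by rewrite mulKg.
by rewrite mulKVg.
Qed.

(** The columns at [ord_max] and at its preimage under [s] both have the largest level, so both sit
    at the peak and coincide. *)
Lemma unimodal_fix_max n (s p : 'S_n.+1) :
  unimodal_fun (fun i => column_level s (p i)) -> s ord_max = ord_max.
Proof.
case/unimodal_funP=> m [incr decr].
have at_peak x : column_level s x = ord_max -> x = p m.
  move=> lx; apply/eqP/negPn/negP => ne_x.
  have := unimodal_fun_max incr decr; move/(_ (p^-1 x)%g).
  rewrite permKV lx -(inj_eq (@perm_inj _ p)) permKV => /(_ ne_x) /=.
  by have := ltn_ord (column_level s (p m)); lia.
have lmax : column_level s ord_max = ord_max.
  by apply: ord_inj; rewrite val_column_level /=; have := ltn_ord (s ord_max); lia.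
have lpre : column_level s (s^-1 ord_max)%g = ord_max.
  apply: ord_inj; rewrite val_column_level permKV /=.
  by have := ltn_ord (s^-1 ord_max)%g; lia.
by rewrite {1}(at_peak _ lmax) -(at_peak _ lpre) permKV.
Qed.

(** * Removing the fixed largest element *)

Lemma lift_perm_image n (t : 'I_n.+1) :
  [set s : 'S_n.+1 | s t == t] = lift_perm t t @: [set: 'S_n].
Proof.
apply/setP=> s; rewrite inE; apply/eqP/imsetP => [st|[s' _ ->]]; last first.
  exact: lift_perm_id.
(* As [s] fixes [t], it never sends [lift t x] to [t], so [unlift] succeeds. *)
pose s0 x := odflt x (unlift t (s (lift t x))).
have s0E x : lift t (s0 x) = s (lift t x).
  rewrite /s0; case: unliftP => [y ->//|/= slx].
  by have := neq_lift t x; rewrite -(inj_eq (@perm_inj _ s)) st slx eqxx.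
have s0_inj : injective s0.
  by move=> x y eq_xy; apply/(@lift_inj _ t)/(@perm_inj _ s); rewrite -!s0E eq_xy.
exists (perm s0_inj) => //; apply/permP=> x.
by case: (unliftP t x) => [y ->|->]; rewrite ?lift_perm_id // lift_perm_lift permE s0E.
Qed.

Lemma lift_perm_inj n (t u : 'I_n.+1) : injective (lift_perm t u : 'S_n -> _).
Proof.
move=> s1 s2 /permP eq12; apply/permP=> x; apply: (@lift_inj _ u).
by rewrite -!(lift_perm_lift t).
Qed.

Lemma column_level_lift n (s : 'S_n) x :
  column_level (lift_perm ord_max ord_max s) (lift ord_max x)
    = lift ord_max (column_level s x).
Proof.
by apply: ord_inj; rewrite val_column_level lift_perm_lift !lift_max val_column_level.
Qed.

Lemma column_level_max n (s : 'S_n) :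
  column_level (lift_perm ord_max ord_max s) ord_max = ord_max.
Proof. by rewrite /column_level lift_perm_id ltnn. Qed.

(** The added column is the only one of level [ord_max], so no double level arises; the other levels
    are merely relabelled. *)
Lemma card_double_column_levels_lift n (s : 'S_n) :
  #|double_column_levels (lift_perm ord_max ord_max s)|
    = #|double_column_levels s|.
Proof.
rewrite -[RHS](card_imset _ (@lift_inj _ ord_max)); apply: eq_card => v.
case: (unliftP ord_max v) => [w ->|->].
  rewrite (mem_imset _ _ (@lift_inj _ _)) !inE; congr (_ == _).
  rewrite -[RHS](card_imset _ (@lift_inj _ ord_max)); apply: eq_card => x.
  case: (unliftP ord_max x) => [y ->|->].
    rewrite (mem_imset _ _ (@lift_inj _ _)) !inE column_level_lift.
    by rewrite (inj_eq (@lift_inj _ _)).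
  rewrite inE column_level_max (negPf (neq_lift _ _)).
  by apply/esym/imsetP => -[y _ /eqP]; rewrite (negPf (neq_lift _ _)).
transitivity false; last first.
  by apply/esym/imsetP => -[y _ /eqP]; rewrite (negPf (neq_lift _ _)).
rewrite inE; apply/negbTE.
suff -> : [set x | column_level (lift_perm ord_max ord_max s) x == ord_max]
    = [set ord_max] by rewrite cards1.
apply/setP=> x; rewrite !inE; case: (unliftP ord_max x) => [y ->|->].
  by rewrite column_level_lift !(eq_sym (lift _ _)) !(negPf (neq_lift _ _)).
by rewrite column_level_max !eqxx.
Qed.

Lemma card_unimodal_lift n (s : 'S_n) :
  #|[set p : 'S_n.+1 | unimodal_fun
       (fun i => column_level (lift_perm ord_max ord_max s) (p i))]|
    = 2 ^ (n - #|double_column_levels s|).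
Proof.
set f := column_level _.
have f_lt_max x : x != ord_max -> f x < f ord_max.
  rewrite /f column_level_max; case: (unliftP ord_max x) => [y ->|->].
    by rewrite column_level_lift lift_max /= ltn_ord.
  by rewrite eqxx.
rewrite (card_unimodal_orderings f_lt_max) card_two_chains.
- by rewrite card_ord -card_double_column_levels_lift.
- exact: column_level_fiber.
move=> x fx; apply/eqP/negPn/negP => /f_lt_max.
by rewrite fx ltnn.
Qed.

(* The series has finitely many nonzero terms: for every N >= n its partial sum
   over k < N is U n. *)
Theorem theorem3p12 (n N : nat) (n_gt0 : 0 < n) (le_nN : n <= N) :
  U n = \sum_(0 <= k < N) 2 ^ (n - k - 1) * R n.-1 k.
Proof.
case: n n_gt0 le_nN => // n _ lt_nN.
have -> : U n.+1 = \sum_(s : 'S_n) 2 ^ (n - #|double_column_levels s|).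
  rewrite card_unimodal (bigID (fun s : 'S_n.+1 => s ord_max == ord_max)) /=.
  rewrite [X in _ + X]big1 ?addn0 => [|s /negP fix_s]; last first.
    apply: eq_card0 => p; apply/negbTE/negP; rewrite inE => up.
    by apply: fix_s; rewrite (unimodal_fix_max up).
  rewrite (eq_bigl (mem (lift_perm ord_max ord_max @: [set: 'S_n]))) => [|s].
    rewrite big_imset /=; last by move=> s1 s2 _ _; apply: lift_perm_inj.
    under eq_bigl do rewrite inE.
    by apply: eq_bigr => s _; apply: card_unimodal_lift.
  by rewrite /= -lift_perm_image inE.
under [RHS]eq_bigr do rewrite /= card_canonical big_distrr /=.
rewrite exchange_big /=; apply: eq_bigr => s _.
(* For fixed [s] only the term with [k] equal to its number of double levels survives. That number
   is at most [n], hence within the summation range. *)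
have lt_dN : #|double_column_levels s| < N.
  by apply: leq_trans lt_nN; rewrite ltnS -[X in _ <= X]card_ord max_card.
rewrite big_mkord (bigD1 (Ordinal lt_dN)) //= eqxx muln1 big1 => [|k].
  by rewrite addn0; congr (2 ^ _); lia.
by rewrite -val_eqE /= eq_sym => /negPf->; rewrite muln0.
Qed.
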